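(* Let $\Phi$ be of type $A_n$. A set $S$ of roots is of the form $S=w(B(I))$ for some $i\in[n]$, $w\in W^i$ and $I\in\mathcal I_{ab}(\alpha_i)$ (i.e. $\operatorname{conv}(S)$ is a simplex of the triangulation $\{\operatorname{conv}(w(B(I)))\mid i\in[n], w\in W^i, I\in\mathcal I_{ab}(\alpha_i)\}$ of the boundary of $\mathcal P$) if and only if $S$ is the set of roots corresponding to an $n$-anti-standard graph.
   Context: $\Phi$ is the root system of type $A_n$ with simple roots $\alpha_1,\dots,\alpha_n$, positive roots $\alpha_{i,j}=\sum_{h=i}^j\alpha_h$ ($1\le i\le j\le n$), highest root $\theta=\alpha_{1,n}$, Weyl group $W$ with length $\ell$, $\mathcal P=\operatorname{conv}(\Phi)$. $W^i=\{w\in W\mid \ell(ws_{\alpha})>\ell(w)\ \forall\alpha\in\Pi\setminus\{\alpha_i\}\}$ (minimal length left coset representatives of $W/W\langle\Pi\setminus\{\alpha_i\}\rangle$). The root poset is $\Phi^+$ with $\beta\ge\gamma$ iff $\beta-\gamma$ is a nonnegative integer combination of simple roots; an abelian ideal is a subset $I\subseteq\Phi^+$ closed upward with $(I+I)\cap\Phi=\emptyset$; its border is $B(I)=\{\beta\in I\mid\gamma_1,\gamma_2\in\Pi,\ \beta-\gamma_1\in\Phi^+,\ \beta-\gamma_2\in\Phi^+\Rightarrow\beta-\gamma_1-\gamma_2\notin I\}$. Affine setup: adjoin $\delta$ with the form extended to have kernel $\mathbb R\delta$; $\widehat\Phi=\Phi+\mathbb Z\delta$, $\widehat\Pi=\Pi\cup\{-\theta+\delta\}$,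 $\widehat\Phi^+=\Phi^+\cup(\Phi+\mathbb Z_{>0}\delta)$, $\widehat W$ generated by reflections in $\widehat\Pi$; $N(w)=\{\beta\in\widehat\Phi^+\mid w^{-1}(\beta)\in-\widehat\Phi^+\}$; $w_I$ is the unique element with $N(w_I)=\{-\beta+\delta\mid\beta\in I\}$; $\mathcal I_{ab}(\alpha)=\{I\mid w_I^{-1}(-\theta+2\delta)=\alpha\}$. An $n$-anti-standard graph is a simple directed graph (no loops, no multiple edges) with vertex set $[n+1]$ and exactly $n$ edges such that (1) every vertex is either a source of some edges or a target of some edges, but not both; (2) for any edges $(s,t)$ and $(s',t')$ (source, target), $s<s'$ implies $t\le t'$. An edge $(i,j)$ with $i<j$ corresponds to the root $\alpha_{i,j-1}$, and an edge $(j,i)$ with $i<j$ to $-\alpha_{i,j-1}$; the set of roots corresponding to a graph is the set of roots of its edges. *)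

(* Defs.v *)
(* Type A_n root system realised in Z^{n+1} (standard model:
   simple root alpha_h = e_{h} - e_{h+1}, 0-indexed), affine roots as pairs
   (finite part, coefficient of delta). Weyl group elements are words in the
   simple reflections, acting by composition of reflections. *)
From HB Require Import structures.
From mathcomp Require Import all_boot all_order all_algebra.
Set Implicit Arguments. Unset Strict Implicit. Unset Printing Implicit Defensive.
Import Order.TTheory GRing.Theory Num.Theory.
Local Open Scope ring_scope.

Section An.
Variable n : nat.

Definition V := {ffun 'I_n.+1 -> int}.

Definition evec (j : 'I_n.+1) : V := [ffun k => ((k == j)%N)%:Z].

Definition dot (u v : V) : int := \sum_(k < n.+1) u k * v k.

(* simple root alpha_{h+1} (paper indexing) = e_h - e_{h+1}, for h < n *)
Definition simple_nat (h : nat) : V :=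
  [ffun k : 'I_n.+1 => ((k == h :> nat)%N)%:Z - ((k == h.+1 :> nat)%N)%:Z].
Definition simple (h : 'I_n) : V := simple_nat h.

(* alpha_range a b = sum_{a <= h < b} simple root h; paper's alpha_{i,j}
   is alpha_range (i-1) j. *)
Definition alpha_range (a b : nat) : V := \sum_(a <= h < b) simple_nat h.

Definition pos_root (v : V) : Prop :=
  exists a b : nat, (a < b)%N /\ (b <= n)%N /\ v = alpha_range a b.
Definition is_root (v : V) : Prop := pos_root v \/ pos_root (- v).
Definition theta : V := alpha_range 0 n.

Definition root_le (g b : V) : Prop :=
  exists c : 'I_n -> nat, b - g = \sum_(h < n) (simple h *+ c h).

Definition abelian_ideal (I : V -> Prop) : Prop :=
  [/\ (forall b, I b -> pos_root b),
      (forall b g, I b -> pos_root g -> root_le b g -> I g) &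
      (forall b g, I b -> I g -> ~ is_root (b + g))].

Definition border (I : V -> Prop) (b : V) : Prop :=
  I b /\ forall g1 g2 : 'I_n, pos_root (b - simple g1) ->
          pos_root (b - simple g2) -> ~ I (b - simple g1 - simple g2).

(* reflection in a root a (all roots have (a,a) = 2, so a^vee = a) *)
Definition refl (a v : V) : V := v - a *~ dot v a.

Definition wact (w : seq 'I_n) (v : V) : V :=
  foldr (fun h x => refl (simple h) x) v w.

Definition same_elt (u w : seq 'I_n) : bool :=
  [forall j : 'I_n.+1, wact u (evec j) == wact w (evec j)].

Definition has_len (w : seq 'I_n) (k : nat) : bool :=
  [exists t : k.-tuple 'I_n, same_elt t w].

Lemma has_len_ex (w : seq 'I_n) : exists k, has_len w k.
Proof.
exists (size w); apply/existsP; exists (in_tuple w).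
by apply/forallP => j /=.
Qed.

Definition wlength (w : seq 'I_n) : nat := ex_minn (has_len_ex w).

(* W^i : minimal length left coset representatives *)
Definition inWi (i : 'I_n) (w : seq 'I_n) : Prop :=
  forall h : 'I_n, h != i -> (wlength w < wlength (w ++ [:: h]))%N.

Definition AV := (V * int)%type.   (* (v, k) stands for v + k delta *)
Definition aopp (x : AV) : AV := (- x.1, - x.2).

Definition apos (x : AV) : Prop :=
  (x.2 = 0 /\ pos_root x.1) \/ (0 < x.2 /\ is_root x.1).

Definition aff_simple (h : 'I_n.+1) : AV :=
  if (h < n)%N then (simple_nat h, 0) else (- theta, 1).

Definition arefl (b x : AV) : AV :=
  (x.1 - b.1 *~ dot x.1 b.1, x.2 - b.2 * dot x.1 b.1).

Definition aact (w : seq 'I_n.+1) (x : AV) : AV :=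
  foldr (fun h y => arefl (aff_simple h) y) x w.

Definition ainv_act (w : seq 'I_n.+1) (x : AV) : AV := aact (rev w) x.

Definition Nset (w : seq 'I_n.+1) (x : AV) : Prop :=
  apos x /\ apos (aopp (ainv_act w x)).

(* I in I_ab(alpha): I abelian ideal and w_I^{-1}(-theta + 2 delta) = alpha,
   where w_I is (the) element with N(w_I) = {-beta + delta | beta in I}. *)
Definition Iab (alpha : V) (I : V -> Prop) : Prop :=
  abelian_ideal I /\
  exists w : seq 'I_n.+1,
    (forall x, Nset w x <-> exists b, I b /\ x = (- b, 1)) /\
    ainv_act w (- theta, 2) = (alpha, 0).

(* ---------- anti-standard graphs (vertices 0..n stand for 1..n+1) ---------- *)
Definition anti_standard (E : {set 'I_n.+1 * 'I_n.+1}) : Prop :=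
  [/\ (forall e, e \in E -> e.1 != e.2),
      #|E| = n,
      (forall v : 'I_n.+1,
          (exists2 e, e \in E & e.1 = v) <-> ~ (exists2 e, e \in E & e.2 = v)) &
      (forall e e', e \in E -> e' \in E -> (e.1 < e'.1)%N -> (e.2 <= e'.2)%N)].

(* edge (i,j), i<j, gives alpha_{i,j-1}; edge (j,i), i<j, gives -alpha_{i,j-1}
   (paper's 1-indexed vertices; here shifted by one) *)
Definition edge_root (e : 'I_n.+1 * 'I_n.+1) : V :=
  if (e.1 < e.2)%N then alpha_range e.1 e.2 else - alpha_range e.2 e.1.

End An.

(* Main.v *)
(* A root of type A_n is a difference e_a - e_b, and w acts by a permutation
   sigma of {0, ..., n}; since the length is the number of inversions, W^i
   consists of the w whose sigma is increasing on [0, i] and on [i + 1, n].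

   Writing w_I^-1(e_a) = e_(tau a) + p_a delta, the condition
   w_I^-1(- theta + 2 delta) = alpha_i forces tau 0 = i + 1, tau n = i, and
   sum_a p_a = 0 then yields that I contains e_0 - e_(i+1) and e_i - e_n.
   Conversely an abelian ideal containing both is a staircase of cells (a, b)
   in the rectangle [0, i] x [i + 1, n]; it encodes a total order on
   {0, ..., n}, and ranking the indices in this order provides w_I.

   The border of such a staircase is a chain of cells which meets each of the
   n antidiagonals a + b = k, i < k <= i + n, exactly once.  Its images under
   the sigma above are the anti-standard graphs: given a graph, number its
   sources first, then its targets, each in increasing order; having n edges,
   it meets every antidiagonal, so it is the border of the staircase which it
   generates. *)
Require Import Defs.
From mathcomp Require Import all_boot all_order all_algebra.
From mathcomp Require Import all_fingroup zify.
Set Implicit Arguments. Unset Strict Implicit. Unset Printing Implicit Defensive.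
Import Order.TTheory GRing.Theory Num.Theory.
Local Open Scope ring_scope.

(** * Roots and the action of words *)

Section Roots.
Variable n : nat.
Implicit Types (v : V n) (s t : 'S_n.+1).

(** Indexing by a natural number avoids casts to ordinals; [ev k] vanishes for k > n. *)
Definition ev (k : nat) : V n := [ffun j : 'I_n.+1 => ((j == k :> nat)%N)%:Z].

Lemma evecE (j : 'I_n.+1) : evec j = ev j.
Proof. by apply/ffunP => k; rewrite !ffunE. Qed.

Lemma simple_natE h : simple_nat n h = ev h - ev h.+1.
Proof. by apply/ffunP => k; rewrite !ffunE. Qed.

Lemma alpha_rangeE a b : (a <= b)%N -> alpha_range n a b = ev a - ev b.
Proof.
move=> leab; rewrite /alpha_range (eq_bigr (fun h => - (ev h.+1 - ev h))).
  by rewrite sumrN telescope_sumr // opprB.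
by move=> h _; rewrite simple_natE opprB.
Qed.

Lemma ev_inj_diff a b c d : (a <= n)%N -> (b <= n)%N -> (c <= n)%N -> (d <= n)%N ->
  a != b -> ev a - ev b = ev c - ev d -> a = c /\ b = d.
Proof.
move=> an bn cn dn ab /ffunP E.
have Ea := E (inord a); have Eb := E (inord b).
rewrite !ffunE !inordK ?ltnS // in Ea Eb.
by lia.
Qed.

Lemma pos_rootP v :
  pos_root v <-> exists a b, [/\ (a < b)%N, (b <= n)%N & v = ev a - ev b].
Proof.
split=> [[a [b [ab [bn ->]]]]|[a [b [ab bn ->]]]].
  by exists a, b; rewrite alpha_rangeE // ltnW.
by exists a, b; rewrite alpha_rangeE // ltnW.
Qed.

Lemma is_rootP v : is_root v <->
  exists a b, [/\ (a <= n)%N, (b <= n)%N, a != b & v = ev a - ev b].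
Proof.
split=> [[]|[a [b [an bn ab ->]]]].
- by move=> /pos_rootP[a [b [ab bn ->]]]; exists a, b; split=> //; lia.
- move=> /pos_rootP[a [b [ab bn E]]]; exists b, a.
  by rewrite -[v]opprK E opprB; split=> //; lia.
have [lt_ab|le_ba] := ltnP a b.
  by left; apply/pos_rootP; exists a, b.
by right; apply/pos_rootP; exists b, a; rewrite opprB; split=> //; lia.
Qed.

Lemma pos_root_ev a b : (a <= n)%N -> (b <= n)%N -> a != b ->
  pos_root (ev a - ev b) <-> (a < b)%N.
Proof.
move=> an bn ab; split=> [/pos_rootP[c [d [cd dn E]]]|ltab].
  by have [||||-> ->] := ev_inj_diff _ _ _ _ ab E; lia.
by apply/pos_rootP; exists a, b.
Qed.

Lemma dot_ev (a b : 'I_n.+1) v : dot v (ev a - ev b) = v a - v b.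
Proof.
rewrite /dot; under eq_bigr do rewrite !ffunE mulrBr.
have aux (c : 'I_n.+1) : \sum_(i < n.+1) v i * ((i == c :> nat)%N)%:Z = v c.
  rewrite (bigD1 c) //= eqxx mulr1 big1 ?addr0 // => i.
  by rewrite -val_eqE => /negPf/= ->; rewrite mulr0.
by rewrite sumrB !aux.
Qed.

Lemma ev_ord (a b : 'I_n.+1) : ev a b = ((b == a)%N)%:Z.
Proof. by rewrite ffunE. Qed.

Lemma refl_ev (a b j : 'I_n.+1) : refl (ev a - ev b) (ev j) = ev (tperm a b j).
Proof.
rewrite /refl dot_ev !ev_ord.
case: tpermP => [->|->|/eqP/negPf ja /eqP/negPf jb].
- rewrite eqxx; have [->|ne] := eqVneq b a; first by rewrite !subrr mul0rz subr0.
  by rewrite subr0 mulr1z opprB addrC subrK.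
- rewrite eqxx; have [->|ne] := eqVneq b a; first by rewrite !subrr mul0rz subr0.
  by rewrite sub0r mulrN1z opprK addrC subrK.
- by rewrite ![_ == j]eq_sym ja jb subrr mulr0z subr0.
Qed.

Definition lo (h : 'I_n) : 'I_n.+1 := widen_ord (leqnSn n) h.
Definition hi (h : 'I_n) : 'I_n.+1 := lift ord0 h.

Lemma simpleE h : simple h = ev (lo h) - ev (hi h).
Proof. exact: simple_natE. Qed.

Definition stp h : 'S_n.+1 := tperm (lo h) (hi h).

(** Products of permutations apply their left factor first, so putting [stp h] on the right lets the
    first letter act last, as in [wact]. *)
Definition wperm (w : seq 'I_n) : 'S_n.+1 :=
  foldr (fun h p => (p * stp h)%g) 1%g w.

Lemma dotB v1 v2 v : dot (v1 - v2) v = dot v1 v - dot v2 v.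
Proof.
by rewrite /dot -sumrB; apply: eq_bigr => i _; rewrite !ffunE mulrBl.
Qed.

Lemma reflB (u v1 v2 : V n) : refl u (v1 - v2) = refl u v1 - refl u v2.
Proof. by rewrite /refl dotB mulrzBr [in LHS]opprD addrACA -opprD. Qed.

Lemma wactB (w : seq 'I_n) v1 v2 : wact w (v1 - v2) = wact w v1 - wact w v2.
Proof. by elim: w => //= h w ->; rewrite reflB. Qed.

Lemma wact_ev (w : seq 'I_n) (j : 'I_n.+1) : wact w (ev j) = ev (wperm w j).
Proof.
elim: w => [|h w IH] /=; first by rewrite perm1.
by rewrite IH simpleE refl_ev permM.
Qed.

Lemma wperm_rcons w h : wperm (rcons w h) = (stp h * wperm w)%g.
Proof. by elim: w => [|g w IH] /=; rewrite ?mulg1 ?mul1g // IH mulgA. Qed.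

Lemma ev_inj (a b : 'I_n.+1) : ev a = ev b -> a = b.
Proof.
move/ffunP/(_ a); rewrite !ev_ord eqxx.
by case: eqP.
Qed.

Lemma same_eltE u w : same_elt u w = (wperm u == wperm w).
Proof.
apply/forallP/eqP => [E|E j]; last by rewrite evecE !wact_ev E.
by apply/permP => j; apply: ev_inj; rewrite -!wact_ev -evecE; apply/eqP.
Qed.

Lemma root_le_ev a b c d : (a < b <= n)%N -> (c < d <= n)%N ->
  root_le (ev c - ev d : V n) (ev a - ev b) <-> (a <= c /\ d <= b)%N.
Proof.
move=> /andP[ab bn] /andP[cd dn]; split=> [[m E]|[ac db]].
  (* The sum of the coordinates up to k < n reads off the coefficient of the simple root k, so it is
     nonnegative on the right-hand side of [E]. *)
  pose f k (v : V n) : int := \sum_(j < n.+1 | (j <= k)%N) v j.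
  have f_ev k x : (x <= n)%N -> f k (ev x) = ((x <= k)%N)%:Z.
    move=> xn; rewrite /f; have [xk|kx] := leqP x k.
      rewrite (bigD1 (inord x)) /= ?inordK // ffunE inordK // eqxx big1 ?addr0 //.
      move=> j; rewrite -val_eqE /= inordK // ffunE => /andP[_ /negPf ->] //.
    rewrite big1 // => j jk; rewrite ffunE; case: eqP => // jx; lia.
  have fB k u v : f k (u - v) = f k u - f k v.
    by rewrite /f -sumrB; apply: eq_bigr => j _; rewrite !ffunE.
  have fge k : 0 <= f k (ev a - ev b - (ev c - ev d)).
    rewrite E /f.
    under eq_bigr do rewrite sum_ffunE.
    rewrite exchange_big /= sumr_ge0 // => h _.
    have -> : \sum_(j < n.+1 | (j <= k)%N) (simple h *+ m h) j
       = f k (simple h) *+ m h.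
      by rewrite /f -sumrMnl; apply: eq_bigr => j _; rewrite ffunMnE.
    apply: mulrn_wge0; rewrite /simple simple_natE fB !f_ev; try by have := ltn_ord h; lia.
  (* k = c yields a <= c, and k = d - 1 yields d <= b. *)
  have := fge c; have := fge d.-1; rewrite !fB !f_ev; lia.
(* The difference is (e_a - e_c) + (e_d - e_b), two sums of consecutive simple roots. *)
exists (fun h => (a <= h < c) + (d <= h < b))%N.
have sumE x y : (x <= y <= n)%N ->
    ev x - ev y = \sum_(h < n) simple h *+ (x <= h < y) :> V n.
  move=> /andP[xy yn]; rewrite -alpha_rangeE // /alpha_range.
  rewrite (big_nat_widenl x 0) // (big_nat_widen 0 y n) // big_mkord.
  rewrite [RHS](bigID (fun h : 'I_n => x <= h < y)%N) /= [X in _ + X]big1 ?addr0.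
    by apply: eq_big => [h|h /andP[-> ->]].
  by move=> h /negPf ->.
under eq_bigr do rewrite mulrnDr.
rewrite big_split /= -!sumE; try lia.
by rewrite opprB addrACA [RHS]addrACA [- ev b + _]addrC.
Qed.

End Roots.

(** * Length and inversions *)

Section Length.
Variable n : nat.
Implicit Types (s : 'S_n.+1) (h : 'I_n).

Definition invset s : {set 'I_n.+1 * 'I_n.+1} :=
  [set x : 'I_n.+1 * 'I_n.+1 | (x.1 < x.2)%N && (s x.2 < s x.1)%N].
Definition inv s := #|invset s|.

Lemma stpE h (a : 'I_n.+1) :
  stp h a = (if a == h :> nat then h.+1 else if a == h.+1 :> nat then h : nat else a) :> nat.
Proof.
case: tpermP => [->|->|/eqP ne1 /eqP ne2] /=.
- by rewrite eqxx.
- by rewrite /bump /= add1n eqxx ifF //; lia.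
- by move: ne1 ne2; rewrite -!val_eqE /= /bump /= add1n => /negPf -> /negPf ->.
Qed.

Lemma lo_lt_hi h : (lo h < hi h)%N. Proof. by rewrite /= /bump add1n. Qed.

Lemma stpK h : involutive (stp h). Proof. exact: tpermK. Qed.

(** Exchanging the positions h and h + 1 carries the inversions of s to those of the product; the
    only new one is the pair (h, h + 1) itself. *)
Lemma inv_stp s h : (s (lo h) < s (hi h))%N -> inv (stp h * s)%g = (inv s).+1.
Proof.
move=> asc.
pose f (x : 'I_n.+1 * 'I_n.+1) := (stp h x.1, stp h x.2).
have fK : involutive f by move=> [a b]; rewrite /f /= !stpK.
have stp_lo : stp h (lo h) = hi h by rewrite /stp tpermL.
have stp_hi : stp h (hi h) = lo h by rewrite /stp tpermR.
have -> : inv (stp h * s)%g = #|(lo h, hi h) |: f @: invset s|.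
  rewrite /inv; apply: eq_card => -[a b].
  rewrite !inE -[(a, b) in RHS]fK (mem_imset _ _ (inv_inj fK)) !inE /= !permM xpair_eqE !stpK.
  have [/andP[/eqP-> /eqP->]|ne] /= := boolP ((a == lo h) && (b == hi h)).
    by rewrite stp_lo stp_hi asc /bump add1n ltnSn.
  have [/andP[/eqP-> /eqP->]|ne'] /= := boolP ((a == hi h) && (b == lo h)).
    by rewrite stp_lo stp_hi ltnNge ltnW //= andbC ltnNge ltnW.
  rewrite /= in ne *; congr (_ && _); rewrite !stpE.
  by move: ne ne'; rewrite -!val_eqE /= /bump add1n; repeat case: eqP; lia.
rewrite cardsU1 card_imset; last exact: inv_inj.
rewrite -[(lo h, hi h)]fK (mem_imset _ _ (inv_inj fK)) inE /= stp_lo stp_hi.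
by rewrite ltnNge ltnW // lo_lt_hi.
Qed.


Lemma perm_cmp s h : (s (hi h) < s (lo h))%N = ~~ (s (lo h) < s (hi h))%N.
Proof.
rewrite -leqNgt [RHS]leq_eqVlt [_ == _ :> nat]val_eqE (inj_eq perm_inj).
by rewrite -val_eqE /= gtn_eqF // lo_lt_hi.
Qed.

Lemma inv_stp_desc s h : (s (hi h) < s (lo h))%N -> inv s = (inv (stp h * s)%g).+1.
Proof.
move=> desc; rewrite -(@inv_stp _ h) ?permM ?tpermL ?tpermR //.
by rewrite mulgA /stp tperm2 mul1g.
Qed.

Lemma ascents_gap s (a b : 'I_n.+1) :
    (forall h, a <= h < b -> s (lo h) < s (hi h))%N ->
  (a <= b -> s a + (b - a) <= s b)%N.
Proof.
case: b => b bn; elim: b bn => [|b IH] bn asc ab.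
  have -> : a = Ordinal bn by apply: val_inj => /=; move: ab => /=; lia.
  by rewrite subnn addn0.
have [->|ne] := eqVneq a (Ordinal bn); first by rewrite subnn addn0.
have ab' : (a <= b)%N by move: ne ab; rewrite -val_eqE /=; lia.
have bn' : (b < n)%N by [].
have := asc (Ordinal bn'); rewrite /= ab' ltnSn => /(_ isT).
have -> : lo (Ordinal bn') = Ordinal (ltnW bn) by apply: val_inj.
have -> : hi (Ordinal bn') = Ordinal bn by apply: val_inj.
have : (s a + (b - a) <= s (Ordinal (ltnW bn)))%N.
  by apply: IH => // h /andP[ah hb]; apply: asc; rewrite /= ah ltnW.
by rewrite subSn //; lia.
Qed.

(** Counting ascents from 0 gives a <= s a, and counting them up to n gives s a <= a. *)
Lemma ascents_id s : (forall h, s (lo h) < s (hi h))%N -> s = 1%g.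
Proof.
move=> asc; apply/permP => a; rewrite perm1; apply: val_inj => /=.
have := @ascents_gap s ord0 a; have := @ascents_gap s a ord_max.
move=> /(_ (fun h _ => asc h) (leq_ord _)) le1 /(_ (fun h _ => asc h) isT) le2.
move: le1 le2 (ltn_ord (s a)) (ltn_ord (s ord_max)) (ltn_ord a) => /=; lia.
Qed.

(** Sorting by adjacent exchanges: each descent removed costs one letter and one inversion. *)
Lemma inv_word s : exists2 w, size w = inv s & wperm w = s.
Proof.
have [k] := ubnP (inv s); elim: k s => // k IH s le_s.
have [/forallP asc|] := boolP [forall h, (s (lo h) < s (hi h))%N].
  have -> := ascents_id asc; exists [::] => //=.
  apply/esym/eqP; rewrite cards_eq0; apply/eqP/setP => x.
  by rewrite !inE !perm1; lia.
case/forallPn => h; rewrite -perm_cmp => desc.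
have E := inv_stp_desc desc.
have [|w sz Ew] := IH (stp h * s)%g; first by rewrite -ltnS -E.
exists (rcons w h); first by rewrite size_rcons sz E.
by rewrite wperm_rcons Ew mulgA /stp tperm2 mul1g.
Qed.

Lemma inv_le_size (w : seq 'I_n) : (inv (wperm w) <= size w)%N.
Proof.
elim/last_ind: w => [|w h IH].
  rewrite leqn0 cards_eq0; apply/eqP/setP => x.
  by rewrite !inE !perm1; lia.
rewrite size_rcons wperm_rcons.
have [asc|] := boolP (wperm w (lo h) < wperm w (hi h))%N; first by rewrite inv_stp.
by rewrite -perm_cmp => /inv_stp_desc; lia.
Qed.

Lemma wlengthE (w : seq 'I_n) : wlength w = inv (wperm w).
Proof.
rewrite /wlength; case: ex_minnP => k /existsP[t /[!same_eltE] /eqP E] kmin.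
have := inv_le_size t; rewrite size_tuple -E => le_k.
apply/eqP; rewrite eqn_leq le_k andbT.
have [u sz Eu] := inv_word (wperm t); apply: kmin.
apply/existsP; rewrite -sz; exists (in_tuple u).
by rewrite same_eltE /= Eu E.
Qed.

(** Right multiplication by a simple reflection exchanges two adjacent positions, so the length
    grows exactly at an ascent. *)
Lemma inWiP (i : 'I_n) w : inWi i w <->
  forall h, h != i -> (wperm w (lo h) < wperm w (hi h))%N.
Proof.
split=> asc h /asc; rewrite cats1 !wlengthE wperm_rcons.
  by apply: contraTT; rewrite -perm_cmp -leqNgt => /inv_stp_desc->.
by move/inv_stp->.
Qed.

End Length.

(** * Affine words *)

Section Affine.
Variable n : nat.
Implicit Types (v p q : V n) (s t : 'S_n.+1) (u w : seq 'I_n.+1) (k l : int).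

(** The e_j are not roots, but affine reflections act on them too, and [t] and [p] then determine
    the action on all affine roots. *)
Definition acts u t p :=
  forall j : 'I_n.+1, aact u (ev n j, 0) = (ev n (t j), p j).

(** Since delta lies in the kernel of the form, the extra term [l] is carried along unchanged. *)
Lemma aactB u v1 v2 k1 k2 l :
  aact u (v1 - v2, k1 - k2 + l) =
    ((aact u (v1, k1)).1 - (aact u (v2, k2)).1,
     (aact u (v1, k1)).2 - (aact u (v2, k2)).2 + l).
Proof.
elim: u => //= h u ->; rewrite /arefl /=.
move: (aact u (v1, k1)) (aact u (v2, k2)) => [x1 m1] [x2 m2] /=.
congr (_, _); last by rewrite dotB mulrBr; lia.
by rewrite dotB mulrzBr opprD addrACA -opprD.
Qed.

Lemma aact_shift u v k : aact u (v, k) = ((aact u (v, 0)).1, (aact u (v, 0)).2 + k).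
Proof.
elim: u => [|h u IH] /=; first by rewrite add0r.
by rewrite IH /arefl /= addrAC.
Qed.

Lemma acts_diff u t p (a b : 'I_n.+1) k : acts u t p ->
  aact u (ev n a - ev n b, k) = (ev n (t a) - ev n (t b), p a - p b + k).
Proof. by move=> up; rewrite -[k]add0r -[0 in LHS](subrr 0) aactB !up /= add0r. Qed.

Lemma aact_cat u w (x : AV n) : aact (u ++ w) x = aact u (aact w x).
Proof. by rewrite /aact foldr_cat. Qed.

Lemma acts_cat u w s t p q : acts u s p -> acts w t q ->
  acts (u ++ w) (t * s)%g [ffun j => p (t j) + q j].
Proof.
by move=> up wq j; rewrite aact_cat wq aact_shift up /= permM ffunE.
Qed.

Lemma acts_nil : acts [::] 1%g 0.
Proof. by move=> j; rewrite perm1 ffunE. Qed.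

Lemma thetaE : theta n = ev n (@ord0 n) - ev n (@ord_max n).
Proof. by rewrite /theta alpha_rangeE. Qed.

Lemma arefl_ev (a b j : 'I_n.+1) k :
  arefl (ev n a - ev n b, k) (ev n j, 0) =
    (ev n (tperm a b j), - (k * (((j == a)%N)%:Z - ((j == b)%N)%:Z))).
Proof.
rewrite /arefl -refl_ev /refl; congr (_, _).
by rewrite dot_ev !ev_ord sub0r ![_ == j]eq_sym.
Qed.

Lemma aff_simpleE (h : 'I_n.+1) :
  exists (a b : 'I_n.+1) k, aff_simple h = (ev n a - ev n b, k).
Proof.
rewrite /aff_simple; case: ifP => hn.
  by exists h, (inord h.+1), 0; rewrite simple_natE inordK.
by exists ord_max, ord0, 1; rewrite thetaE opprB.
Qed.

Lemma sum_pick (a : 'I_n.+1) : \sum_j ((j == a)%N)%:Z = 1 :> int.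
Proof. by rewrite (bigD1 a) //= eqxx big1 ?addr0 // => j /negPf->. Qed.

(** The reflection in e_a - e_b + k delta shifts e_a and e_b by opposite multiples of delta, so the
    total shift stays zero. *)
Lemma acts_exists u : exists t p, acts u t p /\ \sum_j p j = 0.
Proof.
elim: u => [|h u [t [p [up p0]]]].
  exists 1%g, 0; split; first exact: acts_nil.
  by rewrite big1 // => j _; rewrite ffunE.
have [a [b [k E]]] := aff_simpleE h.
pose q : V n := [ffun j => - (k * (((j == a)%N)%:Z - ((j == b)%N)%:Z))].
have hq : acts [:: h] (tperm a b) q.
  by move=> j; rewrite /= E arefl_ev ffunE.
exists (t * tperm a b)%g, [ffun j => q (t j) + p j].
split; first exact: (acts_cat hq up).
under eq_bigr do rewrite ffunE.
rewrite big_split /= p0 addr0 -(reindex_inj (P := xpredT) (F := fun j => q j) (@perm_inj _ t)) /=.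
under eq_bigr do rewrite ffunE.
by rewrite sumrN -mulr_sumr sumrB !sum_pick subrr mulr0 oppr0.
Qed.

(** * Realising all permutations and all shifts of sum zero by affine words *)

Lemma acts_fin s : exists u, acts u s 0.
Proof.
have [w _ <-] := inv_word s; exists (map (@lo n) w) => j.
rewrite ffunE -wact_ev; elim: w => //= h w ->.
rewrite /aff_simple /= ltn_ord /arefl /= mul0r subr0.
by rewrite /refl /simple.
Qed.

Definition is_translation p := exists u, acts u 1%g p.

Lemma acts_ext u s t p q : s =1 t -> p =1 q -> acts u s p -> acts u t q.
Proof. by move=> st pq up j; rewrite up st pq. Qed.

Lemma translationD p q : is_translation p -> is_translation q -> is_translation (p + q).
Proof.
move=> [u up] [w wq]; exists (u ++ w).
by apply: acts_ext (acts_cat up wq) => j; rewrite ?mulg1 // !ffunE perm1.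
Qed.

Lemma translation0 : is_translation 0. Proof. exists [::]; exact: acts_nil. Qed.

(** The reflection in - theta + delta followed by the one in theta is a translation along theta;
    conjugating by a permutation with a -> 0 and b -> n turns theta into e_a - e_b. *)
Lemma translation_root (a b : 'I_n.+1) : is_translation (ev n a - ev n b).
Proof.
have [->|ab] := eqVneq a b; first by rewrite subrr; exact: translation0.
have n0 : (0 < n)%N.
  by case: posnP a b ab => // -> a b; rewrite !ord1.
have max_ne0 : (ord_max : 'I_n.+1) != ord0 by rewrite -val_eqE /= -lt0n.
pose s := (tperm b ord_max * tperm (tperm b ord_max a) ord0)%g.
have sb : s b = ord_max.
  rewrite permM tpermL tpermD // ?[ord0 == _]eq_sym //.
  by rewrite -[X in _ != X](tpermL b) (inj_eq perm_inj).
have sa : s a = ord0 by rewrite permM tpermL.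
have [u us] := acts_fin s; have [u' us'] := acts_fin (s^-1)%g.
have [w ws] := acts_fin (tperm ord_max ord0).
pose q : V n := [ffun j => - (((j == ord_max)%N)%:Z - ((j == ord0)%N)%:Z)].
have hq : acts [:: ord_max] (tperm ord_max ord0) q.
  move=> j; rewrite /= /aff_simple ltnn thetaE opprB arefl_ev.
  by rewrite ffunE mul1r.
exists (u' ++ (w ++ ([:: ord_max] ++ u))).
apply: acts_ext (acts_cat us' (acts_cat ws (acts_cat hq us))) => j.
  by rewrite 3!permM tpermK permK perm1.
have eq_sj c d : s c = d -> (s j == d) = (j == c :> nat).
  by move <-; rewrite (inj_eq perm_inj).
by rewrite !ffunE add0r addr0 add0r (eq_sj _ _ sa) (eq_sj _ _ sb) opprB.
Qed.

Lemma translation_mulz p k : is_translation p -> is_translation (- p) ->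
  is_translation (p *~ k).
Proof.
have nat_case q (m : nat) : is_translation q -> is_translation (q *+ m).
  move=> hq; elim: m => [|m IH]; first by rewrite mulr0n; exact: translation0.
  by rewrite mulrS; apply: translationD.
by case: k => m hp hNp; rewrite ?NegzE ?mulrNz -?mulNrz -pmulrn; apply: nat_case.
Qed.

(** When its coordinates sum to zero, p is the combination of the vectors e_a - e_0 with
    coefficients p_a. *)
Lemma translation_sum0 p : \sum_j p j = 0 -> is_translation p.
Proof.
move=> p0.
have -> : p = \sum_(a < n.+1) (ev n a - ev n (@ord0 n)) *~ p a.
  apply/ffunP => j; rewrite sum_ffunE.
  under eq_bigr do rewrite ffunMzE !ffunE -mulrzr mulrBl intz.
  rewrite sumrB -mulr_sumr p0 mulr0 subr0 (bigD1 j) //= eqxx mul1r big1 ?addr0 //.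
  by move=> a; rewrite eq_sym -val_eqE => /negPf /= ->; rewrite mul0r.
elim/big_ind: _ => [||a _]; [exact: translation0|exact: translationD|].
by apply: translation_mulz; rewrite ?opprB; apply: translation_root.
Qed.

Lemma acts_onto t p : \sum_j p j = 0 -> exists u, acts u t p.
Proof.
move=> /translation_sum0[u up]; have [w wt] := acts_fin t.
exists (w ++ u); apply: acts_ext (acts_cat wt up) => j.
  by rewrite mul1g.
by rewrite !ffunE add0r.
Qed.

End Affine.

(** * The ideals in I_ab(alpha_i) *)

Lemma sum_geq N m : (\sum_(j < N) (m <= j))%N = (N - m)%N.
Proof.
elim: N => [|N IH]; first by rewrite big_ord0.
by rewrite big_ord_recr /= IH; lia.
Qed.

Lemma sum_geqz N m : \sum_(j < N) ((m <= j)%N)%:Z = (N - m)%N%:Z.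
Proof. by rewrite -sum_geq -[RHS]natz natr_sum; apply: eq_bigr => j _; rewrite natz. Qed.

Lemma sum_ltnz N m : (m <= N)%N -> \sum_(j < N) ((j < m)%N)%:Z = m%:Z.
Proof.
move=> mN; have -> : m%:Z = N%:Z - (N - m)%N%:Z by lia.
rewrite -sum_geqz -[X in X%:Z - _]subn0 -sum_geqz -sumrB.
by apply: eq_bigr => j _; lia.
Qed.

(** The rank counts predecessors; it is injective because the order is strict and total. *)
Lemma rank_perm n (R : rel 'I_n.+1) :
    irreflexive R -> transitive R -> (forall a b, a != b -> R a b || R b a) ->
  exists s : 'S_n.+1, (forall a, s a = #|[set c | R c a]| :> nat)
                    /\ (forall a b, (s a < s b)%N = R a b).
Proof.
move=> Rirr Rtr Rtot.
have rk_lt a : (#|[set c | R c a]| < n.+1)%N.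
  rewrite -[X in (_ < X)%N]card_ord -cardsT; apply/proper_card/properP.
  by split; [exact: subsetT|exists a; rewrite ?inE ?Rirr].
pose f a := Ordinal (rk_lt a).
have fR a b : R a b -> (f a < f b)%N.
  move=> Rab; apply/proper_card/properP; split.
    by apply/subsetP => c; rewrite !inE => /Rtr; apply.
  by exists a; rewrite ?inE ?Rirr.
have f_inj : injective f.
  move=> a b fab; apply/eqP/negPn/negP => /Rtot/orP[] /fR; by rewrite fab ltnn.
exists (perm f_inj); split=> [a|a b]; rewrite !permE //.
apply/idP/idP; last exact: fR.
have [->|/Rtot/orP[//|/fR lt1 lt2]] := eqVneq a b; first by rewrite ltnn.
by have := ltn_trans lt1 lt2; rewrite ltnn.
Qed.

Section AbelianIdeals.
Variable n : nat.
Implicit Types (v p q : V n) (s t : 'S_n.+1) (u w : seq 'I_n.+1) (k l : int).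

(** Since |a - b| < n + 1, the sign of k decides when k is nonzero, and for k = 0 the inequality
    reads a < b. *)
Lemma apos_ev (a b : nat) k : (a <= n)%N -> (b <= n)%N -> a != b ->
  apos (ev n a - ev n b, k) <-> a%:Z - b%:Z < k * n.+1%:Z.
Proof.
move=> an bn ab; rewrite /apos /= pos_root_ev //.
have rab : is_root (ev n a - ev n b) by apply/is_rootP; exists a, b.
split=> [[[-> ltab]|[k0 _]]|lt]; [lia|nia|].
case: (ltrgtP k 0) => [k0|k0|k0]; [nia|by right|].
by left; split=> //; subst k; lia.
Qed.

(* The position of w^-1(e_a) when e_j + k delta is placed at j - k (n + 1) on
   the integer line, so that e_a - e_b + k delta is positive iff its first term
   lies to the left of its second one. *)
Definition pos t p (a : 'I_n.+1) : int := (t a)%:Z - n.+1%:Z * p a.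

(** Positions of distinct indices have distinct residues t a and t b modulo n + 1. *)
Lemma pos_neq t p a b k : a != b -> pos t p a - pos t p b != k * n.+1%:Z.
Proof.
rewrite -(inj_eq (@perm_inj _ t)) -val_eqE /pos /= => ne; apply/eqP => E.
have {}E : (t a)%:Z - (t b)%:Z = (k + p a - p b) * n.+1%:Z.
  by rewrite mulrBl mulrDl -E ![p _ * _]mulrC; lia.
have := ltn_ord (t a); have := ltn_ord (t b).
move: (k + p a - p b) E => d; have [->|] : d = 0 \/ d != 0 by lia.
  by lia.
by nia.
Qed.

(** The first inequality says that the root is positive, the second that its image under w^-1 is
    negative. *)
Lemma Nset_ev w t p (a b : 'I_n.+1) k : acts (rev w) t p -> a != b ->
  Nset w (ev n a - ev n b, k) <->
    a%:Z - b%:Z < k * n.+1%:Z /\ k * n.+1%:Z < pos t p a - pos t p b.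
Proof.
move=> wp ab; rewrite /Nset apos_ev ?leq_ord // /ainv_act (acts_diff _ _ _ wp).
rewrite /aopp /= opprB apos_ev ?leq_ord //; last first.
  by rewrite val_eqE (inj_eq perm_inj) eq_sym.
by rewrite /pos; split=> -[h1 h2]; split=> //; nia.
Qed.

(** The pair (a, b) stands for e_a - e_b. By closure, the two corner cells make [J] meet every row
    and every column of the rectangle. *)
Definition staircase (i : nat) (J : rel nat) : Prop :=
  [/\ forall a b, J a b -> [&& a <= i, i < b & b <= n]%N,
      forall a b a' b', J a b -> (a' <= a)%N -> (b <= b' <= n)%N -> J a' b',
      J 0%N i.+1 & J i n].

Definition ideal_of (J : rel nat) v : Prop :=
  exists a b, J a b /\ v = ev n a - ev n b.

Lemma Iab_staircase (i : 'I_n) (I : V n -> Prop) : Iab (simple i) I ->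
  exists2 J, staircase i J & forall v, I v <-> ideal_of J v.
Proof.
move=> [[Ipos Iup Iab] [w [NwE]]].
have [t [p [wp p0]]] := acts_exists (rev w).
have iN := ltn_ord i.
pose x := pos t p; pose N := n.+1%:Z.
have NE := fun a b => @Nset_ev w t p a b _ wp.
have INw v : I v <-> Nset w (- v, 1).
  split=> [Iv|/NwE[b [Ib [/oppr_inj ->]]] //].
  by apply/NwE; exists v.
have Nw1 (a b : 'I_n.+1) k : Nset w (ev n a - ev n b, k) -> k = 1.
  by move=> /NwE[b' [_ [_ ->]]].
(* N(w) contains no root with delta coefficient 0, so no positive e_a - e_b is inverted and
   positions increase with the index. *)
have x_lt (a b : 'I_n.+1) : (a < b)%N -> x a < x b.
  move=> ltab; have ab : a != b by rewrite -val_eqE /= ltn_eqF.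
  rewrite ltNge; apply/negP => le_ba.
  suff /Nw1 : Nset w (ev n a - ev n b, 0) by [].
  apply/NE => //; rewrite mul0r; split; first lia.
  by have := pos_neq t p 0 ab; rewrite mul0r -/x; lia.
rewrite /ainv_act thetaE opprB (acts_diff _ _ _ wp) simpleE.
move=> [E pmax].
have ne_t : t ord_max != t ord0 :> nat.
  by rewrite val_eqE (inj_eq perm_inj) -val_eqE /=; lia.
have [||||tmax t0] := ev_inj_diff _ _ _ _ ne_t E; rewrite ?leq_ord //.
  exact: ltnW.
rewrite /= in tmax t0.
(* [r] and [c] are the remainder and the quotient of x a - x 0 by N. *)
pose r a : int := (t a)%:Z - i.+1%:Z + N * ((t a <= i)%N)%:Z.
pose c a : int := p ord0 - p a - ((t a <= i)%N)%:Z.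
have r_bd a : 0 <= r a < N by rewrite /r /N; have := ltn_ord (t a); lia.
have xE a : x a = x ord0 + r a + N * c a.
  by rewrite /x /pos /r /c t0 /bump /=; rewrite -/N; nia.
have x_le (a b : 'I_n.+1) : (a <= b)%N -> x a <= x b.
  by rewrite leq_eqVlt => /orP[/eqP/val_inj->|/x_lt/ltW].
have xmax : x ord_max = x ord0 + N + N - 1.
  by rewrite /x /pos t0 tmax /bump /= -/N; nia.
(* All positions lie between x 0 and x n = x 0 + 2N - 1. *)
have c_bd a : 0 <= c a <= 1.
  have := @x_le ord0 a (leq0n _); have := x_le a ord_max (leq_ord _).
  rewrite xmax xE; have := r_bd a; rewrite /N; nia.
have c_le (a b : 'I_n.+1) : (a <= b)%N -> c a <= c b.
  by move=> /x_le; rewrite (xE a) (xE b); have := r_bd a; have := r_bd b; nia.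
have sumc : \sum_a c a = N * p ord0 - i.+1%:Z.
  rewrite /c !sumrB p0 subr0 sumr_const card_ord.
  rewrite -(reindex_inj (P := xpredT) (F := fun j : 'I_n.+1 => ((j <= i)%N)%:Z) (@perm_inj _ t)) /=.
  under [X in _ - X]eq_bigr do rewrite -ltnS.
  rewrite sum_ltnz //; last by rewrite ltnS ltnW.
  by rewrite -mulr_natl natz.
have c0 : c ord0 = 0 by rewrite /c t0 /bump /=; lia.
have sum_bd : 0 <= \sum_a c a <= n%:Z.
  apply/andP; split; first by apply: sumr_ge0 => a _; have /andP[] := c_bd a.
  rewrite big_ord_recl c0 add0r.
  have -> : n%:Z = \sum_(a < n) 1 by rewrite sumr_const card_ord natz.
  apply: ler_sum => a _.
  by have := c_bd (lift ord0 a); lia.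
(* The sum is N p_0 - (i + 1) and lies in [0, n], which leaves only p_0 = 1. *)
have sumcE : \sum_a c a = (n - i)%N%:Z.
  have p01 : p ord0 = 1 by move: sum_bd; rewrite sumc /N; nia.
  by rewrite sumc p01 /N; lia.
(* A nondecreasing 0/1 sequence on [0, n] with n - i ones vanishes exactly on [0, i]. *)
have c_i : c (lo i) = 0.
  have [//|ci1] : c (lo i) = 0 \/ c (lo i) = 1 by have := c_bd (lo i); lia.
  have : \sum_(a < n.+1) ((i <= a)%N)%:Z <= \sum_a c a.
    apply: ler_sum => a _; have [ia|_] := leqP i a.
      by have := @c_le (lo i) a ia; rewrite ci1.
    by have := c_bd a; lia.
  by rewrite sumcE sum_geqz; lia.
have c_hi : c (hi i) = 1.
  have [ci0|//] : c (hi i) = 0 \/ c (hi i) = 1 by have := c_bd (hi i); lia.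
  have : \sum_a c a <= \sum_(a < n.+1) ((i.+2 <= a)%N)%:Z.
    apply: ler_sum => a _; have [ia|ia] := leqP i.+2 a.
      by have := c_bd a; lia.
    by have := @c_le a (hi i); rewrite ci0; apply; rewrite /= /bump add1n; lia.
  by rewrite sumcE sum_geqz; lia.
have c_lo (a : 'I_n.+1) : (a <= i)%N -> c a = 0.
  by move=> ai; have := c_bd a; have := @c_le a (lo i) ai; rewrite c_i; lia.
have c_gt (a : 'I_n.+1) : (i < a)%N -> c a = 1.
  by move=> ai; have := c_bd a; have := @c_le (hi i) a ai; rewrite c_hi; lia.
pose J (a b : nat) := [&& (a <= n)%N, (b <= n)%N & N < x (inord b) - x (inord a)].
have INJ a b : (a <= n)%N -> (b <= n)%N -> (a < b)%N ->
    I (ev n a - ev n b) <-> J a b.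
  move=> an bn ltab; rewrite INw opprB.
  have -> : ev n a = ev n (@inord n a) by rewrite inordK.
  have -> : ev n b = ev n (@inord n b) by rewrite inordK.
  rewrite NE; last by rewrite -val_eqE /= !inordK //; lia.
  rewrite /J an bn /= !inordK // mul1r; split=> [[]|] //.
  by split=> //; lia.
(* A difference above N needs c a = 0 and c b = 1, as remainders differ by less than N. *)
have Jsub a b : J a b -> [&& a <= i, i < b & b <= n]%N.
  case/and3P => an bn; rewrite bn (xE (inord a)) (xE (inord b)) => lt.
  have := r_bd (inord a); have := r_bd (inord b).
  have := c_bd (inord a); have := c_bd (inord b).
  have := @c_lo (inord b); have := @c_gt (inord a); rewrite !inordK //.
  by case: (leqP a i); case: (leqP b i) => //= _ _ c1 c2; nia.
exists J.
  split=> //.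
  - move=> a b a' b' Jab a'a /andP[bb' b'n].
    have /and3P[an bn lt] := Jab; rewrite /J b'n (leq_trans a'a an) /=.
    apply: lt_le_trans lt _; apply: lerB; apply: x_le; rewrite !inordK //.
    exact: leq_trans a'a an.
  (* For both corner cells the difference is at least N, and [pos_neq] excludes equality. *)
  - have -> : J 0%N i.+1 = (N < x (hi i) - x ord0).
      rewrite /J /= iN; congr (_ < x _ - x _); apply: val_inj; rewrite /= inordK //.
    have := @pos_neq t p (hi i) ord0 1 isT; rewrite mul1r -/x -/N.
    by rewrite (xE (hi i)) c_hi mulr1; have := r_bd (hi i); lia.
  - have -> : J i n = (N < x ord_max - x (lo i)).
      rewrite /J /= leqnn ltnW //=.
      by congr (_ < x _ - x _); apply: val_inj; rewrite /= inordK // ltnS ltnW.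
    have ne : ord_max != lo i by rewrite -val_eqE /=; lia.
    have := @pos_neq t p _ _ 1 ne; rewrite mul1r -/x -/N.
    by rewrite xmax (xE (lo i)) c_i mulr0 addr0; have := r_bd (lo i); lia.
move=> v; split=> [Iv|[a [b [Jab ->]]]].
  have /pos_rootP[a [b [ltab bn Ev]]] := Ipos _ Iv; rewrite Ev in Iv.
  by exists a, b; rewrite -INJ //; lia.
by have := Jsub _ _ Jab => ?; apply/INJ => //; lia.
Qed.

Lemma root_le_up (J : rel nat) i a b v : staircase i J -> J a b -> pos_root v ->
  root_le (ev n a - ev n b) v -> ideal_of J v.
Proof.
move=> [Jsub Jup _ _] Jab /pos_rootP[c [d [cd dn ->]]].
have /and3P[ai ib bn] := Jsub _ _ Jab.
move=> /root_le_ev[||ca bd]; [lia|lia|].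
by exists c, d; split=> //; apply: Jup Jab _ _ => //; rewrite bd.
Qed.

(** First indices are at most i and second ones exceed i, so nothing cancels: the positive
    coordinates of the sum add up to 2, those of a root to 1. *)
Lemma ideal_of_sum (J : rel nat) i v v' : staircase i J ->
  ideal_of J v -> ideal_of J v' -> ~ is_root (v + v').
Proof.
move=> [Jsub _ _ _] [a [b [/Jsub/and3P[ai ib bn] ->]]].
move=> [c [d [/Jsub/and3P[ci id dn] ->]]] /is_rootP[e [f [en fn ef /ffunP E]]].
have an : (a < n.+1)%N by lia.
have cn : (c < n.+1)%N by lia.
have := E (inord a); have := E (inord c); rewrite !ffunE !inordK //.
have [ab ad] : a != b /\ a != d by lia.
have [cb cd] : c != b /\ c != d by lia.
rewrite !eqxx (negPf ab) (negPf ad) (negPf cb) (negPf cd) (eq_sym c a).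
have [->|ac] := eqVneq a c; first by case: (_ == e); case: (_ == f) => /=; lia.
case: (eqVneq a e) ac => [->|_] ac; last by case: (_ == f) => /=; lia.
by rewrite [c == e]eq_sym (negPf ac); case: (c == f) => /=; lia.
Qed.

Lemma staircase_Iab (i : 'I_n) (J : rel nat) :
  staircase i J -> Iab (simple i) (ideal_of J).
Proof.
move=> HJ; have [Jsub Jup J0 Jn] := HJ; have iN := ltn_ord i.
split.
  split; last by move=> v v'; apply: ideal_of_sum HJ.
    move=> _ [a [b [/Jsub/and3P[ai ib bn] ->]]].
    by apply/pos_rootP; exists a, b; split=> //; lia.
  by move=> _ v [a [b [Jab ->]]]; apply: root_le_up HJ Jab.
(* A low index c precedes a high index a exactly when (c, a) is in [J]; within each block the order
   is the natural one. *)
pose R (c a : 'I_n.+1) :=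
  if (c <= i)%N then if (a <= i)%N then (c < a)%N else J c a
  else if (a <= i)%N then ~~ J a c else (c < a)%N.
have Jle (a b a' b' : 'I_n.+1) : J a b -> (a' <= a)%N -> (b <= b')%N -> J a' b'.
  by move=> Jab a'a bb'; apply: Jup Jab a'a _; rewrite bb' leq_ord.
have Rirr : irreflexive R by move=> a; rewrite /R ltnn; case: (a <= i)%N.
have Rtr : transitive R.
  move=> a c b; rewrite /R; case: ifP => ci; case: ifP => ai; case: ifP => bi.
  - exact: ltn_trans.
  - by move=> ca Jab; apply: Jle Jab _ _ => //; apply: ltnW.
  - by move=> Jca; apply: contraR; rewrite -leqNgt => bc; apply: Jle Jca _ _.
  - by move=> Jca ab; apply: Jle Jca _ _ => //; apply: ltnW.
  - by move=> nJ ab; apply: contra nJ => Jbc; apply: Jle Jbc _ _ => //; apply: ltnW.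
  - by move=> nJ Jab; apply: contraR nJ; rewrite -leqNgt => bc; apply: Jle Jab _ _.
  - by move=> ca; apply: contra => Jbc; apply: Jle Jbc _ _ => //; apply: ltnW.
  - exact: ltn_trans.
have Rtot a b : a != b -> R a b || R b a.
  rewrite -val_eqE /= neq_ltn /R.
  by case: ifP => ai; case: ifP => bi //; rewrite ?orbN // orNb.
have [s [sE sR]] := rank_perm Rirr Rtr Rtot.
have s0 : s ord0 = 0%N :> nat.
  rewrite sE; apply/eqP; rewrite cards_eq0; apply/eqP/setP => c.
  rewrite !inE /R /=; case: ifP => // ci; apply/negbTE/negPn.
  by apply: Jup J0 _ _ => //; rewrite leq_ord andbT ltnNge ci.
have smax : s ord_max = n :> nat.
  rewrite sE [LHS](_ : _ = #|[set~ (@ord_max n)]|); last first.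
    apply: eq_card => c; rewrite !inE /R /= [in X in if _ then X else _]leqNgt iN /=.
    rewrite (leqNgt n) iN /= -val_eqE /=.
    have cn := leq_ord c; have [ci|ci] := leqP c i; last by lia.
    have -> : J c n by apply: Jup Jn _ _ => //; rewrite !leqnn.
    lia.
  by rewrite cardsC1 card_ord.
have sinj : injective s := @perm_inj _ s.
(* [t] and [p] are chosen to put a at position s a + (i + 1) - (n + 1)[a <= i]: t is its residue
   modulo n + 1, and p is minus the quotient. *)
have t_lt (a : 'I_n.+1) : ((if n - i <= s a then s a - (n - i) else s a + i.+1) < n.+1)%N.
  by have := ltn_ord (s a); case: ifP; lia.
pose tf a := Ordinal (t_lt a).
have tf_inj : injective tf.
  move=> a b [E]; apply: sinj; apply: val_inj => /=.
  by move: E; have := ltn_ord (s a); have := ltn_ord (s b); do 2!case: ifP; lia.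
pose t := perm tf_inj.
pose p : V n := [ffun a : 'I_n.+1 => ((a < i.+1)%N)%:Z - ((n - i <= s a)%N)%:Z].
(* Both indicators count i + 1 indices. *)
have p0 : \sum_a p a = 0.
  under eq_bigr do rewrite ffunE.
  rewrite sumrB sum_ltnz; last by rewrite ltnS ltnW.
  rewrite -(reindex_inj (P := xpredT) (F := fun j : 'I_n.+1 => ((n - i <= j)%N)%:Z) sinj) /=.
  by rewrite sum_geqz; lia.
have [u up] := acts_onto t p0.
have wp : acts (rev (rev u)) t p by rewrite revK.
have posE a : pos t p a = (s a)%:Z + i.+1%:Z - n.+1%:Z * ((a <= i)%N)%:Z.
  rewrite /pos /p ffunE /t permE /tf /= ltnS.
  by case: (leqP a i); case: (leqP (n - i) (s a)) => /=; lia.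
exists (rev u); split; last first.
  rewrite /ainv_act thetaE opprB (acts_diff _ _ _ wp).
  rewrite simpleE /p !ffunE /t !permE s0 smax /=.
  have -> : ev n (tf ord_max) = ev n (lo i).
    by congr (ev n _); rewrite /= smax; case: ifP; lia.
  have -> : ev n (tf ord0) = ev n (hi i).
    by congr (ev n _); rewrite /= s0 /bump /=; case: ifP; lia.
  by congr (_, _); lia.
move=> [v k]; split=> [H|[_ [[a [b [Jab ->]]] [-> ->]]]]; last first.
  have /and3P[ai ib bn] := Jsub _ _ Jab; rewrite opprB.
  have [an] : (a <= n)%N /\ (b <= n)%N by lia.
  have -> : ev n a = ev n (@inord n a) by rewrite inordK.
  have -> : ev n b = ev n (@inord n b) by rewrite inordK.
  rewrite (Nset_ev _ wp); last by rewrite -val_eqE /= !inordK //; lia.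
  have : (s (inord a) < s (inord b))%N by rewrite sR /R !inordK // ai leqNgt ib.
  rewrite !posE !inordK //; lia.
have : is_root v.
  by case: H => -[[_ h]|[_ h]] _ //; left.
move=> /is_rootP[a [b [an bn ab Ev]]].
move: H; rewrite {}Ev.
have -> : ev n a = ev n (@inord n a) by rewrite inordK.
have -> : ev n b = ev n (@inord n b) by rewrite inordK.
rewrite (Nset_ev _ wp); last by rewrite -val_eqE /= !inordK.
rewrite !posE !inordK //; have := sR (inord b) (inord a); rewrite /R !inordK //.
have := ltn_ord (s (inord a)); have := ltn_ord (s (inord b)).
move: (val (s (inord a))) (val (s (inord b))) => x y.
move=> yn xn E [lt1 lt2].
(* Positions differ by less than 2(n + 1), which bounds k; k = 0 is impossible because they increase
   with the index. *)
have k0 : 0 <= k by nia.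
have k1 : k <= 1 by move: lt2; case: (leqP a i); case: (leqP b i) => _ _ /=; nia.
have [kE|kE] : k = 0 \/ k = 1 by lia.
  move: E lt1 lt2; rewrite kE mul0r.
  by case: (leqP b i) => bi; case: (leqP a i) => ai /=; lia.
move: E lt1 lt2; rewrite kE mul1r.
case: (leqP b i) => bi; case: (leqP a i) => ai /= E lt1 lt2; try lia.
exists (ev n b - ev n a); rewrite opprB; split=> //.
by exists b, a; split=> //; rewrite -E; lia.
Qed.

End AbelianIdeals.

(** * Borders and anti-standard graphs *)

Section Borders.
Variable n : nat.
Implicit Types (v : V n) (J : rel nat) (E : {set 'I_n.+1 * 'I_n.+1}).

(** Removing one simple root at each end of e_a - e_b leads to the cell (a + 1, b - 1). *)
Definition bord J a b := J a b && ~~ J a.+1 b.-1.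

Lemma pos_root_sub_simple a b g : (a < b <= n)%N -> (g < n)%N ->
  pos_root (ev n a - ev n b - (ev n g - ev n g.+1)) -> g = a \/ g.+1 = b.
Proof.
move=> /andP[ab bn] gn /pos_rootP[e [f [ef fn /ffunP E]]].
have [->|ga] := eqVneq g a; first by left.
have [->|gb] := eqVneq g.+1 b; first by right.
have [aN bN gN] : [/\ a < n.+1, b < n.+1 & g < n.+1]%N by split; lia.
have := E (inord a); have := E (inord b); have := E (inord g).
rewrite !ffunE !inordK // !eqxx (eq_sym b g.+1) (negPf gb) (eq_sym a g) (negPf ga).
rewrite (ltn_eqF ab) (gtn_eqF ab) (ltn_eqF (ltnSn g)).
case: (eqVneq a e) => [ae|_]; last by case: (a == f); case: (a == g.+1) => /=; lia.
case: (eqVneq b f) => [bf|_]; last first.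
  by case: (b == e); case: (b == g) => /=; lia.
rewrite -ae -bf (negPf ga); case: (g == b) => /=; lia.
Qed.

Lemma border_ideal_of i J v : staircase n i J ->
  border (@ideal_of n J) v <-> exists a b, bord J a b /\ v = ev n a - ev n b.
Proof.
move=> HJ; have [Jsub Jup _ _] := HJ; split.
  move=> [[a [b [Jab ->]]] min_v]; exists a, b; split=> //.
  have /and3P[ai ib bn] := Jsub _ _ Jab.
  rewrite /bord Jab; apply/negP => Jab'; have /and3P[ai' ib' _] := Jsub _ _ Jab'.
  have an : (a < n)%N by lia.
  have bn' : (b.-1 < n)%N by lia.
  have bE : b = b.-1.+1 by lia.
  have Ea : simple (Ordinal an) = ev n a - ev n a.+1 by rewrite simpleE.
  have Eb : simple (Ordinal bn') = ev n b.-1 - ev n b.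
    by rewrite simpleE /= [in RHS]bE.
  have E1 : ev n a - ev n b - simple (Ordinal an) = ev n a.+1 - ev n b.
    by rewrite Ea opprB addrC addrA subrK.
  have E2 : ev n a - ev n b - simple (Ordinal bn') = ev n a - ev n b.-1.
    by rewrite Eb opprB addrA subrK.
  apply: (min_v (Ordinal an) (Ordinal bn')).
  - by rewrite E1; apply/pos_rootP; exists a.+1, b; split=> //; lia.
  - by rewrite E2; apply/pos_rootP; exists a, b.-1; split=> //; lia.
  - by rewrite E1 Eb opprB addrA subrK; exists a.+1, b.-1.
move=> [a [b [/andP[Jab nJ] ->]]]; split; first by exists a, b.
have /and3P[ai ib bn] := Jsub _ _ Jab.
move=> g h; rewrite /simple !simple_natE => pg ph.
have abn : (a < b <= n)%N by lia.
have Hg := pos_root_sub_simple abn (ltn_ord g) pg.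
have Hh := pos_root_sub_simple abn (ltn_ord h) ph.
move=> [c [d [Jcd]]]; have /and3P[ci id dn] := Jsub _ _ Jcd.
(* One simple root at each end: the result is the cell (a + 1, b - 1), which is not in [J]. *)
have mixed (x y : nat) : x = a -> y.+1 = b ->
    ev n a - ev n b - (ev n x - ev n x.+1) - (ev n y - ev n y.+1) = ev n c - ev n d ->
    False.
  move=> -> yb; rewrite yb [in X in X - _]opprB [ev n a.+1 - _]addrC addrA.
  rewrite [_ - _ - ev n a]addrAC subrr sub0r opprB addrA [- _ + _]addrC.
  rewrite [X in X - _]addrAC -addrA subrr addr0 => /esym E.
  have [|||||] := ev_inj_diff _ _ _ _ _ E; try lia.
  by move=> ca db; move: nJ; rewrite -ca -yb /= -db Jcd.
have [aN bN] : [/\ a < n.+1 & b < n.+1]%N by split; lia.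
(* With both simple roots at the same end, the coordinate a becomes -1 or the coordinate b becomes
   1, which no cell of [J] allows. *)
case: Hg Hh => [ga|gb] [ha|hb] => [/ffunP/(_ (inord a))||E|/ffunP/(_ (inord b))].
- have [ab ad] : (a == b) = false /\ (a == d) = false by lia.
  by rewrite !ffunE inordK // ga ha eqxx ab ad (ltn_eqF (ltnSn a)); case: (a == c).
- exact: mixed.
- by apply: (mixed h g) => //; rewrite addrAC.
- have [ba bc] : (b == a) = false /\ (b == c) = false by lia.
  have bg : (b == g) = false by lia.
  have bh : (b == h) = false by lia.
  by rewrite !ffunE inordK // gb hb eqxx ba bc bg bh; case: (b == d).
Qed.

(** Were a < a' and b' < b, closure would put (a + 1, b - 1) into [J]. *)
Lemma bord_chain i J a b a' b' : staircase n i J ->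
  bord J a b -> J a' b' -> (a < a')%N -> (b <= b')%N.
Proof.
move=> [Jsub Jup _ _] /andP[Jab nJ] Jab' aa'; rewrite leqNgt.
apply: contra nJ => b'b; have := Jsub _ _ Jab => /and3P[_ _ bn].
by apply: Jup Jab' _ _ => //; lia.
Qed.

(** The next cell inwards on an antidiagonal is (a + 1, b - 1), so the cell of [J] with the largest
    a is a border cell. *)
Lemma bord_diag i J k : staircase n i J -> (i < k <= i + n)%N ->
  exists a b, bord J a b /\ (a + b)%N = k.
Proof.
move=> [Jsub Jup J0 Jn] /andP[ik kn].
have ex : exists a, J a (k - a)%N.
  have [kn'|nk] := leqP k n.
    by exists 0%N; apply: Jup J0 _ _ => //; lia.
  by exists (k - n)%N; apply: Jup Jn _ _ => //; lia.
have ub a : J a (k - a)%N -> (a <= i)%N by case/Jsub/and3P.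
case: (ex_maxnP ex ub) => a Ja amax; have /and3P[ai ia _] := Jsub _ _ Ja.
exists a, (k - a)%N; split; last by lia.
rewrite /bord Ja; apply/negP => Ja'.
by have := amax a.+1; rewrite ltnn subnS => /(_ Ja').
Qed.

(** The smallest b works: (a + 1, b - 1) in [J] would force (a, b - 1) in [J]. *)
Lemma bord_row i J a : staircase n i J -> (a <= i)%N -> exists b, bord J a b.
Proof.
move=> [Jsub Jup J0 Jn] ai.
have ex : exists b, J a b by exists n; apply: Jup Jn ai _; rewrite leqnn.
case: (ex_minnP ex) => b Jab bmin; have /and3P[_ ib bn] := Jsub _ _ Jab.
exists b; rewrite /bord Jab; apply/negP => Jab'.
suff /bmin : J a b.-1 by lia.
by apply: Jup Jab' _ _ => //; lia.
Qed.

Lemma bord_col i J b : staircase n i J -> (i < b <= n)%N -> exists a, bord J a b.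
Proof.
move=> [Jsub Jup J0 Jn] /andP[ib bn].
have ex : exists a, J a b by exists 0%N; apply: Jup J0 _ _ => //; rewrite ib.
have ub a : J a b -> (a <= i)%N by case/Jsub/and3P.
case: (ex_maxnP ex ub) => a Jab amax; exists a; rewrite /bord Jab; apply/negP => Jab'.
suff /amax : J a.+1 b by rewrite ltnn.
by apply: Jup Jab' _ _ => //; lia.
Qed.

(* In a chain of cells of the (i + 1) x (n - i) rectangle, the sum of the two
   coordinates is injective; it takes its values among n consecutive integers. *)
Lemma chain_card E (i : 'I_n) :
    (forall x, x \in E -> x.1 <= i < x.2)%N ->
    (forall x y, x \in E -> y \in E -> (x.1 < y.1)%N -> (x.2 <= y.2)%N) ->
  #|E| = n <-> forall k, (i < k <= i + n)%N -> exists2 x, x \in E & (x.1 + x.2)%N = k.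
Proof.
(* The default value [i] is never taken on [E], where i < x.1 + x.2 <= i + n. *)
move=> Esub Ech; pose f (x : 'I_n.+1 * 'I_n.+1) := insubd i (x.1 + x.2 - i.+1)%N.
have fE x : x \in E -> f x = (x.1 + x.2 - i.+1)%N :> nat.
  case: x => a b /Esub/andP[/= ai ib]; have bn := leq_ord b; have iN := ltn_ord i.
  by rewrite val_insubd ifT //=; lia.
have f_inj : {in E &, injective f}.
  move=> [a b] [c d] xE yE /(congr1 val) /=; rewrite !fE //=.
  have /= := Esub _ xE; have /= := Esub _ yE.
  have /= := Ech _ _ xE yE; have /= := Ech _ _ yE xE.
  move=> h1 h2 h3 h4 h5.
  by congr (_, _); apply: val_inj; move: h1 h2 h3 h4 h5; case: (ltngtP a c) => /=; lia.
rewrite -(card_in_imset f_inj); split=> [fullE k /andP[ik kn]|surj].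
  have fT : f @: E = setT.
    by apply/eqP; rewrite eqEcard subsetT cardsT card_ord fullE leqnn.
  have kn' : (k - i.+1 < n)%N by lia.
  have /imsetP[x xE xk] : Ordinal kn' \in f @: E by rewrite fT.
  have := fE x xE; rewrite -xk /= => kE; exists x => //.
  by case: x xE kE {xk} => a b /Esub/andP[/= ai ib]; lia.
rewrite -[RHS]card_ord -cardsT; congr #|pred_of_set _|; apply/setP => k.
rewrite !inE; apply/imsetP.
have := ltn_ord k => kn.
have [|x xE xk] := surj (k + i.+1)%N; first by lia.
by exists x => //; apply/esym/val_inj; have := fE x xE; rewrite xk addnK.
Qed.

(** * From borders to graphs and back *)

Lemma edge_rootE (e : 'I_n.+1 * 'I_n.+1) : edge_root e = ev n e.1 - ev n e.2.
Proof.
rewrite /edge_root; case: ltnP => le; rewrite alpha_rangeE ?opprB //.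
exact: ltnW.
Qed.


(** Between two indices of the same block no step crosses from i to i + 1, the only place where a
    descent may occur. *)
Lemma block_mono (s : 'S_n.+1) (i : 'I_n) (a b : 'I_n.+1) :
    (forall h, h != i -> s (lo h) < s (hi h))%N ->
  (b <= i)%N || (i < a)%N -> (a < b)%N -> (s a < s b)%N.
Proof.
move=> asc blk ab; have := @ascents_gap n s a b.
suff asc' (h : 'I_n) : (a <= h < b)%N -> (s (lo h) < s (hi h))%N.
  by move=> /(_ asc' (ltnW ab)); lia.
by move=> hab; apply: asc; rewrite -val_eqE /=; lia.
Qed.

Lemma border_anti_standard (i : 'I_n) J (s : 'S_n.+1) : staircase n i J ->
    (forall h, h != i -> s (lo h) < s (hi h))%N ->
  anti_standard [set (s x.1, s x.2) | x in [set x : 'I_n.+1 * 'I_n.+1 | bord J x.1 x.2]].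
Proof.
move=> HJ asc; have [Jsub _ _ _] := HJ.
set B := [set x : 'I_n.+1 * 'I_n.+1 | _].
have Bsub x : x \in B -> (x.1 <= i < x.2)%N.
  by rewrite inE => /andP[/Jsub/and3P[-> ->]].
have lt_iff (a b : 'I_n.+1) : (b <= i)%N || (i < a)%N -> (a <= i)%N = (b <= i)%N ->
    (s a < s b)%N -> (a < b)%N.
  move=> blk same; apply: contraTT; rewrite -!leqNgt leq_eqVlt => /orP[/eqP/val_inj->//|ba].
  by apply/ltnW/(block_mono asc) => //; move: blk same; lia.
split.
- move=> _ /imsetP[x /Bsub xB ->] /=; rewrite (inj_eq perm_inj) -val_eqE /=.
  by case: x xB => a b /=; lia.
- rewrite card_imset; last by move=> [a b] [c d] [/perm_inj-> /perm_inj->].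
  apply/(chain_card Bsub).
    move=> [a b] [c d]; rewrite !inE /= => Bab /andP[Jcd _].
    exact: bord_chain HJ Bab Jcd.
  move=> k kb; have [a [b [Bab abk]]] := bord_diag HJ kb.
  have /andP[/Jsub/and3P[ai ib bn] _] := Bab.
  have an : (a < n.+1)%N by lia.
  by exists (inord a, inord b); rewrite ?inE /= !inordK.
- move=> v; have [a ->] : exists a, v = s a by exists (s^-1 v)%g; rewrite permKV.
  (* As the border meets every row and every column, the sources are the images of [0, i] and the
     targets those of [i + 1, n]. *)
  have -> : (exists2 e, e \in [set (s x.1, s x.2) | x in B] & e.1 = s a) <-> (a <= i)%N.
    split=> [[_ /imsetP[x /Bsub/andP[xi _] ->] /= /perm_inj <-]//|ai].
    have [b Bab] := bord_row HJ ai; have /andP[/Jsub/and3P[_ ib bn] _] := Bab.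
    exists (s a, s (inord b)) => //; apply/imsetP; exists (a, inord b) => //.
    by rewrite inE /= inordK.
  have -> : (exists2 e, e \in [set (s x.1, s x.2) | x in B] & e.2 = s a) <-> (i < a)%N.
    split=> [[_ /imsetP[x /Bsub/andP[_ xi] ->] /= /perm_inj <-]//|ia].
    have [|b Bba] := bord_col HJ (b := a); first by rewrite ia leq_ord.
    have /andP[/Jsub/and3P[bi _ _] _] := Bba.
    have bn : (b < n.+1)%N by have := ltn_ord a; lia.
    exists (s (inord b), s a) => //; apply/imsetP; exists (inord b, a) => //.
    by rewrite inE /= inordK.
  by rewrite leqNgt; split=> /negP.
- move=> _ _ /imsetP[[a b] xB ->] /imsetP[[c d] yB ->] /= sac.
  have /andP[/= ai ib] := Bsub _ xB; have /andP[/= ci id] := Bsub _ yB.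
  have ac : (a < c)%N by apply: lt_iff sac; rewrite ?ai ?ci.
  move: xB yB; rewrite !inE /= => Bab /andP[Jcd _].
  have := bord_chain HJ Bab Jcd ac.
  rewrite leq_eqVlt => /orP[/eqP/val_inj->//|bd].
  by apply/ltnW/(block_mono asc); rewrite // ib orbT.
Qed.

Lemma anti_standard_border E : (0 < n)%N -> anti_standard E ->
  exists (i : 'I_n) J (s : 'S_n.+1), [/\ staircase n i J,
    (forall h, h != i -> s (lo h) < s (hi h))%N &
    E = [set (s x.1, s x.2) | x in [set x : 'I_n.+1 * 'I_n.+1 | bord J x.1 x.2]]].
Proof.
move=> n0 [Eloop Ecard Esrc Ech].
pose A := [set e.1 | e in E].
have src e : e \in E -> e.1 \in A by move=> eE; apply/imsetP; exists e.
have tgt e : e \in E -> e.2 \notin A.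
  move=> eE; apply/negP => /imsetP[e' e'E ee'].
  by case: (Esrc e.2) => H _; apply: H; [exists e'|exists e].
have [e0 e0E] : exists e, e \in E.
  by apply/set0Pn; rewrite -card_gt0 Ecard.
have A_gt0 : (0 < #|A|)%N by apply/card_gt0P; exists e0.1; apply: src.
have A_le : (#|A| <= n)%N.
  rewrite -ltnS -[X in (_ < X)%N]card_ord -cardsT; apply/proper_card/properP.
  by split; [exact: subsetT|exists e0.2; rewrite ?inE ?tgt].
(* The sources are to fill [0, i], hence i + 1 = #|A|. *)
have iN : (#|A|.-1 < n)%N by lia.
pose i := Ordinal iN.
pose R (s t : 'I_n.+1) :=
  if s \in A then (t \in A) ==> (s < t)%N else (t \notin A) && (s < t)%N.
have Rirr : irreflexive R by move=> a; rewrite /R ltnn; case: (a \in A).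
have Rtr : transitive R.
  move=> b a c; rewrite /R; case: (a \in A); case: (b \in A); case: (c \in A) => //=;
  exact: ltn_trans.
have Rtot a b : a != b -> R a b || R b a.
  by rewrite -val_eqE neq_ltn /R; case: (a \in A); case: (b \in A).
have [p [pE pR]] := rank_perm Rirr Rtr Rtot.
have pA a : (p a <= i)%N = (a \in A).
  rewrite -ltnS prednK // pE; apply/idP/idP => [|aA].
    apply: contraTT => aA; rewrite -leqNgt; apply/subset_leq_card/subsetP => c cA.
    by rewrite inE /R cA (negPf aA).
  apply/proper_card/properP; split.
    by apply/subsetP => c; rewrite inE /R aA; case: (c \in A).
  by exists a; rewrite // inE Rirr.
pose F := [set (p e.1, p e.2) | e in E].
have Fsub x : x \in F -> (x.1 <= i < x.2)%N.
  move=> /imsetP[e eE ->] /=; rewrite ltnNge !pA src // tgt //.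
have Fch x y : x \in F -> y \in F -> (x.1 < y.1)%N -> (x.2 <= y.2)%N.
  move=> /imsetP[e eE ->] /imsetP[e' e'E ->] /=.
  rewrite pR /R !src //= => /(Ech _ _ eE e'E).
  rewrite leq_eqVlt => /orP[/eqP/val_inj->//|lt2].
  by apply: ltnW; rewrite pR /R (negPf (tgt _ eE)) tgt.
have Fcard : #|F| = n.
  by rewrite card_imset // => -[a b] [c d] [/perm_inj-> /perm_inj->].
have Fdiag := (chain_card Fsub Fch).1 Fcard.
pose J a b := (b <= n)%N && [exists x in F, (a <= x.1)%N && (x.2 <= b)%N].
have JP a b : reflect ((b <= n)%N /\ exists2 x, x \in F & (a <= x.1)%N && (x.2 <= b)%N) (J a b).
  by apply: (iffP andP) => -[bn /exists_inP]; split.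
have HJ : staircase n i J.
  split.
  - move=> a b /JP[bn [x /Fsub/andP[x1 x2] /andP[ax xb]]].
    by rewrite bn (leq_trans ax x1) (leq_trans x2 xb).
  - move=> a b a' b' /JP[bn [x xF /andP[ax xb]]] a'a /andP[bb' b'n].
    by apply/JP; split=> //; exists x; rewrite // (leq_trans a'a ax) (leq_trans xb bb').
  (* The extreme antidiagonals i + 1 and i + n meet the rectangle only in the corner cells (0, i +
     1) and (i, n). *)
  - have [|x xF xk] := Fdiag i.+1; first by rewrite /=; lia.
    apply/JP; split; first exact: iN.
    by exists x => //; have := Fsub _ xF; case: x xF xk => a b /= _; lia.
  - have [|x xF xk] := Fdiag (i + n)%N; first by rewrite /=; lia.
    apply/JP; split=> //; exists x => //; have := Fsub _ xF.
    by case: x xF xk => a b /= _; have := leq_ord b; rewrite /=; lia.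
exists i, J, (p^-1)%g; split=> //.
  move=> h hi'; rewrite -val_eqE /= in hi'.
  have := pR (p^-1%g (lo h)) (p^-1%g (hi h)); rewrite /R -!pA !permKV lo_lt_hi.
  rewrite /= /bump add1n.
  case: (leqP h #|A|.-1) => h1; case: (leqP h.+1 #|A|.-1) => h2 //= /esym //.
  by move: hi'; rewrite eqn_leq h1 -ltnS h2.
have -> : [set x : 'I_n.+1 * 'I_n.+1 | bord J x.1 x.2] = F.
  apply/setP => -[a b]; rewrite !inE /=; apply/idP/idP => [Bab|abF].
    have /andP[Jab nJ] := Bab; have /JP[bn [[c d] cdF /= /andP[ac db]]] := Jab.
    have /and3P[ai ib _] : [&& a <= i, i < b & b <= n]%N by case: HJ => H _ _ _; apply: H.
    (* [F] has a cell (e, f) on the antidiagonal of (a, b). If a < e, the border cell (a, b) breaks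
       the chain property; if e < a, then (e, f) and (c, d) do. *)
    have [|[e f] efF /= efab] := Fdiag (a + b)%N; first by lia.
    have Jef : J e f by apply/JP; split; [exact: leq_ord|exists (e, f); rewrite //= !leqnn].
    have [ae|ea|ae] := ltngtP a e.
    - by have := bord_chain HJ Bab Jef ae; lia.
    - have ec : (e < c)%N by lia.
      by have := Fch _ _ efF cdF ec; rewrite /=; lia.
    - suff -> : (a, b) = (e, f) by [].
      by congr (_, _); apply: val_inj => //=; lia.
  have /andP[/= ai ib] := Fsub _ abF.
  apply/andP; split.
    by apply/JP; split; [exact: leq_ord|exists (a, b); rewrite //= !leqnn].
  (* Otherwise some cell of [F] would have a larger first and a smaller second coordinate than (a,
     b). *)
  apply/negP => /JP[_ [[c d] cdF /= /andP[ac db]]].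
  by have := Fch _ _ abF cdF ac; rewrite /=; lia.
apply/setP => -[a b]; apply/idP/imsetP => [abE|[_ /imsetP[[c d] cdE ->] /= [-> ->]]].
  by exists (p a, p b); rewrite /= ?permK //; apply/imsetP; exists (a, b).
by rewrite !permK.
Qed.

Lemma wact_border (i : 'I_n) J (w : seq 'I_n) (I : V n -> Prop) :
    staircase n i J -> (forall v, I v <-> @ideal_of n J v) ->
  (forall x, (exists b, border I b /\ x = wact w b) <->
    exists2 e, e \in [set (wperm w x.1, wperm w x.2)
                       | x in [set x : 'I_n.+1 * 'I_n.+1 | bord J x.1 x.2]]
             & x = edge_root e).
Proof.
move=> HJ IE x; have [Jsub _ _ _] := HJ.
have bE v : border I v <-> border (@ideal_of n J) v.
  rewrite /border IE; split=> -[Jv H]; split=> // g h pg ph; have := H g h pg ph; by rewrite IE.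
split=> [[v [/bE/(border_ideal_of _ HJ)[a [b [Bab ->]]] ->]]|].
  have /andP[/Jsub/and3P[ai ib bn] _] := Bab.
  have an : (a < n.+1)%N by lia.
  exists (wperm w (inord a), wperm w (inord b)).
    by apply/imsetP; exists (inord a, inord b); rewrite // inE /= !inordK.
  by rewrite edge_rootE wactB -!wact_ev !inordK.
move=> [_ /imsetP[[a b] Bab ->] ->]; rewrite inE /= in Bab.
exists (ev n a - ev n b); split; last by rewrite edge_rootE wactB !wact_ev.
by apply/bE/(border_ideal_of _ HJ); exists a, b.
Qed.

End Borders.

Theorem theorem7p2 (n : nat) (hn : (1 <= n)%N) (S : V n -> Prop)
    (hS : forall x, S x -> is_root x) :
  (exists (i : 'I_n) (w : seq 'I_n) (I : V n -> Prop),
      [/\ inWi i w, Iab (simple i) I &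
          forall x, S x <-> exists b, border I b /\ x = wact w b])
  <->
  (exists E : {set 'I_n.+1 * 'I_n.+1},
      anti_standard E /\ forall x, S x <-> exists2 e, e \in E & x = edge_root e).
Proof.
split=> [[i [w [I [/inWiP asc /Iab_staircase[J HJ IE] SE]]]]|[E [HE SE]]].
  exists [set (wperm w x.1, wperm w x.2)
           | x in [set x : 'I_n.+1 * 'I_n.+1 | bord J x.1 x.2]].
  split; first exact: border_anti_standard HJ asc.
  by move=> x; rewrite SE; apply: wact_border HJ IE x.
have [i [J [s [HJ asc EE]]]] := anti_standard_border hn HE.
have [w _ ws] := inv_word s; exists i, w, (@ideal_of n J); split.
- by apply/inWiP => h; rewrite ws; apply: asc.
- exact: staircase_Iab.
- move=> x; rewrite SE EE -ws; apply: iff_sym; exact: wact_border HJ _ x.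
Qed.
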